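(* Let $\Gamma^1=(G,\sigma_1,\mu_1)$ be a $\gamma_1$-regular signed graph on $n_1$ vertices and $m_1$ edges, let $\theta$ be any $r$-orientation of the edges of $\Gamma^1$, and let $\Gamma^2=(H,\sigma_2,\mu_2)$ be an arbitrary signed graph on $n_2$ vertices. Let $\lambda_1(Q(\Gamma^1)),\dots,\lambda_{n_1}(Q(\Gamma^1))$ be the eigenvalues of $Q(\Gamma^1)$. If $\lambda$ is not a pole of $\Sigma_{Q(\Gamma^2)}(\lambda-2)$, then $$f_{Q((\Gamma^1\boxminus\Gamma^2)_\theta)}(\lambda)=(\lambda-2)^{m_1-n_1}\big(f_{Q(\Gamma^2)}(\lambda-2)\big)^{m_1}\prod_{j=1}^{n_1}\Big((\lambda-\gamma_1-\gamma_1n_2)(\lambda-2)-\big(1+(\lambda-2)\Sigma_{Q(\Gamma^2)}(\lambda-2)\big)\lambda_j(Q(\Gamma^1))\Big).$$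
   Context: A signed graph $\Gamma=(G,\sigma,\mu)$ has a finite simple graph $G$ with vertices $v_1,\dots,v_n$, signature $\sigma:E(G)\to\{\pm1\}$ and marking $\mu:V(G)\to\{\pm1\}$; $\mu(\Gamma)=(\mu(v_1),\dots,\mu(v_n))^T$. $A(\Gamma)$ has $(i,j)$ entry $\sigma(v_iv_j)$ if $v_i\sim v_j$ and $0$ otherwise; $D(\Gamma)$ is the diagonal matrix of (unsigned) degrees; $Q(\Gamma)=D(\Gamma)+A(\Gamma)$. $\gamma$-regular means all degrees equal $\gamma$. $f_M(\lambda)=\det(\lambda I-M)$. The signed $N$-coronal is the rational function $\Sigma_N(X)=\mu(\Gamma)^T(XI_n-N)^{-1}\mu(\Gamma)$. An $r$-orientation of $(G,\sigma)$ is a map $\theta:V(G)\times E(G)\to\{-1,0,1\}$ with $\theta(w,uv)=0$ for $w\notin\{u,v\}$, $\theta(u,uv)\in\{\pm1\}$ at endpoints, and $\theta(u,uv)\theta(v,uv)=\sigma(uv)$. The subdivision graph $S(\Gamma^1_\theta)$ is obtained by inserting a new vertex $v_e$ into each edge $e$ of $\Gamma^1$, the edge $v_iv_e$ having sign $\theta(v_i,e)$. With $E(\Gamma^1)=\{e_1,\dots,e_{m_1}\}$, the subdivision edge neighbourhood corona $(\Gamma^1\boxminus\Gamma^2)_\theta$ is obtained from $S(\Gamma^1_\theta)$ and $m_1$ disjoint copies of $\Gamma^2$ by joining, for each $t$, both endpoints $v$ of $e_t$ to every vertex $u$ of the $t$-th copy, with sign $\theta(v,e_t)\mu_2(u)$,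 where $\mu_2(u)$ is the marking of the corresponding vertex of $\Gamma^2$.
   Formalization: The case λ = 2 with m_1 < n_1 is excluded, since the factor (λ−2)^{m_1−n_1} is then a negative power of 0 and undefined (for example when Γ^1 is a single edge). *)

(* Defs.v *)
From HB Require Import structures.
From mathcomp Require Import all_boot all_order all_algebra.

Set Implicit Arguments.
Unset Strict Implicit.
Unset Printing Implicit Defensive.

Import Order.TTheory GRing.Theory Num.Theory.
Local Open Scope ring_scope.

Definition is_sign (z : int) : bool := (z == 1) || (z == -1).

Record graph := Graph {
  vertex :> finType;
  adj : rel vertex;
  adj_sym : symmetric adj;
  adj_irr : irreflexive adj }.

Definition edge_set (G : graph) : {set {set G}} :=
  [set e : {set G} | [exists u : G, exists v : G, adj u v && (e == [set u; v])]].

Definition edge (G : graph) : finType := {e : {set G} | e \in edge_set G}.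

Definition degree (G : graph) (u : G) : nat := #|[set v : G | adj u v]|.

Definition regular (G : graph) (k : nat) : Prop := forall u : G, degree u = k.

(* The signature is a function of two vertices, symmetric on adjacent pairs;
   its values on non-adjacent pairs are irrelevant. *)
Record signed_graph := SignedGraph {
  sg_graph :> graph;
  sigma : sg_graph -> sg_graph -> int;
  sigma_sym : forall u v, adj u v -> sigma u v = sigma v u;
  sigma_sign : forall u v, adj u v -> is_sign (sigma u v) }.

(* The triple (G, sigma, mu).  The marking is kept apart from the signature
   because the coronas below come without a marking. *)
Record marked_signed_graph := MarkedSignedGraph {
  msg_signed :> signed_graph;
  mu : msg_signed -> int;
  mu_sign : forall u, is_sign (mu u) }.

Record r_orientation (Gm : signed_graph) := ROrientation {
  theta :> Gm -> edge Gm -> int;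
  theta_out : forall (w : Gm) (e : edge Gm), w \notin val e -> theta w e = 0;
  theta_end : forall (w : Gm) (e : edge Gm), w \in val e -> is_sign (theta w e);
  theta_mul : forall (u v : Gm) (e : edge Gm),
    val e = [set u; v] -> theta u e * theta v e = sigma u v }.

Section Matrices.
Variable F : numFieldType.

Definition adj_mx (Gm : signed_graph) : 'M[F]_#|Gm| :=
  \matrix_(i, j) if adj (enum_val i) (enum_val j)
                 then (sigma (enum_val i) (enum_val j))%:~R else 0.

Definition deg_mx (Gm : signed_graph) : 'M[F]_#|Gm| :=
  diag_mx (\row_i (degree (enum_val i))%:R).

Definition Q_mx (Gm : signed_graph) : 'M[F]_#|Gm| := deg_mx Gm + adj_mx Gm.

Definition mu_vec (Gm : marked_signed_graph) : 'cV[F]_#|Gm| :=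
  \col_i (mu (enum_val i))%:~R.

Definition charf (n : nat) (M : 'M[F]_n) (x : F) : F := \det (x%:M - M).

Definition eigenvalues (n : nat) (M : 'M[F]_n) (lam : 'I_n -> F) : Prop :=
  char_poly M = \prod_(j < n) ('X - (lam j)%:P).

Definition ratfun := {fraction {poly F}}.

(* mu^T (X I - N)^-1 mu, computed over the field F(X). *)
Definition coronal (Gm : marked_signed_graph) (N : 'M[F]_#|Gm|) : ratfun :=
  let m : 'cV[ratfun]_#|Gm| := map_mx (fun c : F => tofrac c%:P) (mu_vec Gm) in
  (m^T *m invmx (map_mx (@tofrac {poly F}) (char_poly_mx N)) *m m) 0 0.

(* \n_ and \d_ give some numerator and denominator, not necessarily coprime. *)
Definition rat_num (r : ratfun) : {poly F} :=
  let p := \n_(repr r) in let q := \d_(repr r) in p %/ gcdp p q.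
Definition rat_den (r : ratfun) : {poly F} :=
  let p := \n_(repr r) in let q := \d_(repr r) in q %/ gcdp p q.

Definition is_pole (r : ratfun) (x : F) : bool := root (rat_den r) x.
Definition rat_eval (r : ratfun) (x : F) : F := (rat_num r).[x] / (rat_den r).[x].

End Matrices.

Section Subdivision.
Variables (Gm : signed_graph) (th : r_orientation Gm).

Definition subdiv_vertex : finType := (Gm + edge Gm)%type.

Definition subdiv_adj : rel subdiv_vertex := fun x y =>
  match x, y with
  | inl v, inr e | inr e, inl v => v \in val e
  | _, _ => false
  end.

Definition subdiv_sigma (x y : subdiv_vertex) : int :=
  match x, y with
  | inl v, inr e | inr e, inl v => th v e
  | _, _ => 0
  end.

Lemma subdiv_adj_sym : symmetric subdiv_adj.
Proof. by case=> [?|?] [?|?]. Qed.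

Lemma subdiv_adj_irr : irreflexive subdiv_adj.
Proof. by case. Qed.

Definition subdiv_graph := Graph subdiv_adj_sym subdiv_adj_irr.

Lemma subdiv_sigma_sym (x y : subdiv_graph) :
  adj x y -> subdiv_sigma x y = subdiv_sigma y x.
Proof. by case: x y => [?|?] [?|?]. Qed.

Lemma subdiv_sigma_sign (x y : subdiv_graph) :
  adj x y -> is_sign (subdiv_sigma x y).
Proof. by case: x y => [?|?] [?|?] //= /theta_end; apply. Qed.

Definition subdivision : signed_graph :=
  SignedGraph subdiv_sigma_sym subdiv_sigma_sign.

End Subdivision.

Section Corona.
Variables (G1 : signed_graph) (th : r_orientation G1) (G2 : marked_signed_graph).

(* inr (e, u) is the vertex u of the copy of G2 attached to the edge e. *)
Definition corona_vertex : finType := (subdivision th + edge G1 * G2)%type.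

Definition corona_adj : rel corona_vertex := fun x y =>
  match x, y with
  | inl a, inl b => adj a b
  | inr (e, u), inr (f, w) => (e == f) && adj u w
  | inl (inl v), inr (e, _) | inr (e, _), inl (inl v) => v \in val e
  | _, _ => false
  end.

Definition corona_sigma (x y : corona_vertex) : int :=
  match x, y with
  | inl a, inl b => sigma a b
  | inr (_, u), inr (_, w) => sigma u w
  | inl (inl v), inr (e, u) | inr (e, u), inl (inl v) => th v e * mu u
  | _, _ => 0
  end.

Lemma corona_adj_sym : symmetric corona_adj.
Proof.
case=> [[v|e]|[e u]] [[w|f]|[f t]] //=.
by rewrite eq_sym adj_sym.
Qed.

Lemma corona_adj_irr : irreflexive corona_adj.
Proof. by case=> [[v|e]|[e u]] //=; rewrite adj_irr andbF. Qed.

Definition corona_graph := Graph corona_adj_sym corona_adj_irr.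

Lemma corona_sigma_sym (x y : corona_graph) :
  adj x y -> corona_sigma x y = corona_sigma y x.
Proof.
case: x y => [[v|e]|[e u]] [[w|f]|[f t]] //=.
by case/andP=> _ /sigma_sym.
Qed.

Lemma is_signM (a b : int) : is_sign a -> is_sign b -> is_sign (a * b).
Proof. by do 2![case/orP=> /eqP ->]. Qed.

Lemma corona_sigma_sign (x y : corona_graph) :
  adj x y -> is_sign (corona_sigma x y).
Proof.
case: x y => [[v|e]|[e u]] [[w|f]|[f t]] //=.
- exact: theta_end.
- by move=> ?; apply: is_signM (mu_sign _); apply: theta_end.
- exact: theta_end.
- by move=> ?; apply: is_signM (mu_sign _); apply: theta_end.
- by case/andP=> _ /sigma_sign.
Qed.

Definition sen_corona : signed_graph :=
  SignedGraph corona_sigma_sym corona_sigma_sign.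

End Corona.

(* Main.v *)
Require Import Defs.
From HB Require Import structures.
From mathcomp Require Import all_boot all_order all_algebra.
From mathcomp Require Import perm ring.

Set Implicit Arguments.
Unset Strict Implicit.
Unset Printing Implicit Defensive.

Import Order.TTheory GRing.Theory Num.Theory.
Local Open Scope ring_scope.

(** Group the subdivision vertex of each edge [e] with the copy of [G2] attached
    to [e]: as an isolated vertex with marking [1], it turns the corona into
    [G1] bordered by [m1] identical blocks, the [e]-th one coupled to [G1] through
    the column [e] of the incidence matrix [B] of the orientation. Since
    [B B^T = Q(G1)], a Schur complement over [F(X)], with [X] standing for
    [lambda - 2], gives a determinant [det (a I - (1/X + Sigma) Q(G1))], which
    splits along the eigenvalues. The point [lambda - 2] may be an eigenvalue of
    [Q(G2)] without being a pole of the coronal, so denominators are cleared in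
    [F[X]], using only the reduced denominator of the coronal, before evaluating. *)

(** * Determinants of reindexed and block matrices *)

Lemma det_reindex (R : comNzRingType) (T : finType) (n : nat) (h : 'I_n -> T)
    (f : T -> T -> R) :
  bijective h ->
  \det (\matrix_(i < #|T|, j < #|T|) f (enum_val i) (enum_val j)) =
  \det (\matrix_(i < n, j < n) f (h i) (h j)).
Proof.
move=> bij_h; have en : n = #|T| by rewrite -(bij_eq_card bij_h) card_ord.
case: _ / (esym en) h bij_h => {en n} h bij_h.
have inj_s : injective (enum_rank \o h).
  exact: inj_comp enum_rank_inj (bij_inj bij_h).
pose s := perm inj_s.
set A := (X in \det X = _).
have -> : \matrix_(i, j) f (h i) (h j) = row_perm s (col_perm s A).
  by apply/matrixP => i j; rewrite !mxE !permE /= !enum_rankK.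
rewrite row_permE col_permE !det_mulmx !det_perm mulrCA.
by rewrite odd_permV -signr_addb addbb mulr1.
Qed.

(** Splitting off a unitriangular factor leaves a block lower triangular matrix. An explicit inverse
    [D'] lets the inverse of a block diagonal [D] be supplied block by block. *)
Lemma det_block_schur (R : comNzRingType) (n k : nat) (A : 'M[R]_n)
    (B : 'M_(n, k)) (C : 'M_(k, n)) (D D' : 'M_k) :
  D' *m D = 1%:M ->
  \det (block_mx A B C D) = \det D * \det (A - B *m D' *m C).
Proof.
move=> D'D.
have -> : block_mx A B C D =
    block_mx 1%:M (B *m D') 0 1%:M *m block_mx (A - B *m D' *m C) 0 C D.
  rewrite mulmx_block !mul1mx !mul0mx !add0r.
  by rewrite -(mulmxA _ _ D) D'D mulmx1 subrK.
by rewrite det_mulmx det_ublock det_lblock !det1 !mul1r mulrC.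
Qed.

Lemma det_castmx (R : comNzRingType) (n k : nat) (e : n = k) (A : 'M[R]_n) :
  \det (castmx (e, e) A) = \det A.
Proof. by case: _ / e; rewrite castmx_id. Qed.

Lemma det_mxdiag (R : comNzRingType) (m : nat) (p_ : 'I_m -> nat)
    (N : forall i, 'M[R]_(p_ i)) :
  \det (\mxdiag_i N i) = \prod_i \det (N i).
Proof.
elim: m p_ N => [|m IHm] p_ N.
  (* The size is an empty sum; generalizing the matrix first lets it be rewritten to [0]. *)
  rewrite [RHS]big_ord0; move: (\mxdiag_i N i); rewrite big_ord0 => M.
  exact: det_mx00.
by rewrite mxdiag_recl det_castmx det_ublock IHm big_ord_recl.
Qed.

Lemma mulmx_mxdiag (R : nzRingType) (m : nat) (p_ : 'I_m -> nat)
    (M N : forall i, 'M[R]_(p_ i)) :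
  \mxdiag_i M i *m \mxdiag_i N i = \mxdiag_i (M i *m N i).
Proof.
rewrite {2}/mxdiag mul_mxdiag_mxblock; apply/eq_mxblock => i j.
by case: eqVneq => [->|_]; rewrite ?mulmx0 // !conform_mx_id.
Qed.

(** In the Schur complement each copy contributes the same scalar [v^T N^-1 v] times the rank-one
    matrix of a column of [B]; these rank-one matrices add up to [B B^T]. *)
Lemma det_bordered_copies (R : comUnitRingType) (n m p : nat) (a : R)
    (B : 'M[R]_(n, m)) (v : 'cV[R]_p) (N : 'M[R]_p) :
  N \in unitmx ->
  \det (block_mx a%:M (- \mxrow_j (col j B *m v^T))
         (- \mxcol_j (v *m (col j B)^T)) (\mxdiag_(j < m) N)) =
  \det N ^+ m * \det (a%:M - (v^T *m invmx N *m v) 0 0 *: (B *m B^T)).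
Proof.
move=> uN.
rewrite (@det_block_schur _ _ _ _ _ _ _ (\mxdiag_(j < m) invmx N)); last first.
  by rewrite mulmx_mxdiag mulVmx // mxdiagZ.
rewrite det_mxdiag prodr_const card_ord; congr (_ * \det (_ - _)).
rewrite mulNmx mulmxN mulNmx opprK mul_mxrow_mxdiag mul_mxrow_mxcol.
set s := _ 0 0; have sE : v^T *m invmx N *m v = s%:M by exact: mx11_scalar.
apply/matrixP => i k; rewrite summxE !mxE mulr_sumr; apply: eq_bigr => j _.
rewrite mulmxA -(mulmxA (col j B)) -(mulmxA (col j B)) sE mul_mx_scalar.
by rewrite -scalemxAl !mxE big_ord1 !mxE.
Qed.

(** For [s != 0] this is [s ^+ n] times the characteristic polynomial at [a / s], which splits by
    hypothesis; [s = 0] is treated apart. *)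
Lemma det_scalar_sub_scale (F K : fieldType) (phi : {rmorphism F -> K}) (n : nat)
    (M : 'M[F]_n) (lam : 'I_n -> F) (a s : K) :
  char_poly M = \prod_(j < n) ('X - (lam j)%:P) ->
  \det (a%:M - s *: map_mx phi M) = \prod_(j < n) (a - s * phi (lam j)).
Proof.
move=> hlam; have [->|s0] := eqVneq s 0.
  rewrite scale0r subr0 det_scalar.
  by under eq_bigr do rewrite mul0r subr0; rewrite prodr_const card_ord.
have -> : a%:M - s *: map_mx phi M = s *: ((a / s)%:M - map_mx phi M).
  by rewrite scalerBr scale_scalar_mx mulrC divfK.
have -> : (a / s)%:M - map_mx phi M =
    map_mx (horner_eval (a / s)) (char_poly_mx (map_mx phi M)).
  apply/matrixP => i j; rewrite !mxE /horner_eval !hornerE.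
  by rewrite hornerMn hornerX.
rewrite detZ det_map_mx -/(char_poly _) -map_char_poly hlam.
rewrite !rmorph_prod -[n in s ^+ n]card_ord -prodr_const.
rewrite -big_split; apply: eq_bigr => j _ /=.
rewrite rmorphB /= /horner_eval map_polyX map_polyC !hornerE mulrBr.
by rewrite mulrCA divff ?mulr1.
Qed.

(** Dividing both components of a representative by their gcd does not change the fraction it
    represents. *)
Lemma rat_numE (F : numFieldType) (r : ratfun F) :
  tofrac (rat_num r) = r * tofrac (rat_den r).
Proof.
set p := \n_(repr r); set q := \d_(repr r).
have q0 : q != 0 := denom_ratioP _.
have g0 : gcdp p q != 0 by rewrite gcdp_eq0 negb_and q0 orbT.
have rE : r * tofrac q = tofrac p.
  rewrite -[r]reprK -[repr r]Ratio_numden -/p -/q; unlock tofrac.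
  rewrite -[LHS]pi_mul; apply/eqmodP; rewrite /= FracField.equivfE /FracField.mulf.
  by rewrite !numden_Ratio ?mulr1 ?oner_eq0 ?mul1r // mulrC.
apply: (@mulIf _ (tofrac (gcdp p q))); first by rewrite tofrac_eq0.
by rewrite -mulrA -!tofracM !divpK ?dvdp_gcdl ?dvdp_gcdr ?rE.
Qed.

(** * Edges, incidence and degrees in a simple graph *)

Lemma edgeP (G : graph) (e : edge G) :
  exists u v : G, [/\ adj u v, u != v & val e = [set u; v]].
Proof.
case: e => e /=; rewrite inE => /existsP[u /existsP[v /andP[uv /eqP->]]].
by exists u, v; split=> //; apply: contraTneq uv => ->; rewrite adj_irr.
Qed.

Lemma adj_edge (G : graph) (u v : G) :
  adj u v -> exists e : edge G, val e = [set u; v].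
Proof.
move=> uv; suff e_in : [set u; v] \in edge_set G.
  by exists (exist (fun e => e \in edge_set G) _ e_in).
by rewrite inE; apply/existsP; exists u; apply/existsP; exists v; rewrite uv /=.
Qed.

Lemma card_edge (G : graph) (e : edge G) : #|val e| = 2%N.
Proof. by have [u [v [_ uv ->]]] := edgeP e; rewrite cards2 uv. Qed.

Lemma edge_of_endpoints (G : graph) (e : edge G) (u v : G) :
  u != v -> u \in val e -> v \in val e -> adj u v /\ val e = [set u; v].
Proof.
have [a [b [ab _ ->]]] := edgeP e; rewrite !inE => uv.
case/orP=> /eqP ua /orP[]/eqP vb; move: uv; rewrite ua vb ?eqxx //= => _.
by rewrite adj_sym setUC.
Qed.

(** Neighbours [w] of [v] correspond to the edges [[set v; w]]; injectivity uses the absence of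
    loops. *)
Lemma card_incident_edges (G : graph) (v : G) :
  #|[set e : edge G | v \in val e]| = degree v.
Proof.
have inj : {in [set w | adj v w] &, injective (fun w => [set v; w])}.
  move=> a b; rewrite !inE => va vb eab.
  have : a \in [set v; b] by rewrite -eab !inE eqxx orbT.
  by rewrite !inE => /orP[/eqP av|/eqP//]; rewrite av adj_irr in va.
rewrite /degree -(card_in_imset inj) -(card_imset _ val_inj).
apply: eq_card => e; apply/imsetP/imsetP => [[f + ->]|[w + ->]]; rewrite inE.
  have [a [b [ab _ ->]]] := edgeP f; rewrite !inE => /orP[]/eqP->.
    by exists b; rewrite ?inE.
  by exists a; rewrite ?inE 1?adj_sym // setUC.
by case/adj_edge=> f ef; exists f; rewrite // inE ef !inE eqxx.
Qed.

Lemma degreeE (G : graph) (u : G) : degree u = (\sum_(v : G) adj u v)%N.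
Proof.
by rewrite /degree -sum1dep_card big_mkcond; apply: eq_bigr => v _; case: adj.
Qed.

(** * Degrees in the corona *)

Section CoronaDegrees.
Variables (G1 : signed_graph) (th : r_orientation G1) (G2 : marked_signed_graph).
Local Notation C := (sen_corona th G2).

Lemma sum_nat_incident (v : G1) : (\sum_(e : edge G1) (v \in val e) = degree v)%N.
Proof.
rewrite -card_incident_edges -sum1dep_card [RHS]big_mkcond.
by apply: eq_bigr => e _; case: (_ \in _).
Qed.

Lemma sum_nat_endpoints (e : edge G1) : (\sum_(v : G1) (v \in val e) = 2)%N.
Proof.
rewrite -(card_edge e) -sum1_card [RHS]big_mkcond.
by apply: eq_bigr => v _; case: (_ \in _).
Qed.

Lemma degree_corona_vertex (v : G1) :
  @degree C (inl (inl v)) = (degree v * (1 + #|G2|))%N.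
Proof.
rewrite degreeE big_sumType big_sumType /= big1_eq add0n sum_nat_incident.
rewrite mulnDr muln1; congr (_ + _)%N.
rewrite (eq_bigr (fun p : edge G1 * G2 => (v \in val p.1) : nat)); last by case.
rewrite -(pair_bigA _ (fun (e : edge G1) (_ : G2) => (v \in val e) : nat))%N /=.
rewrite -sum_nat_incident big_distrl /=.
by apply: eq_bigr => e _; rewrite sum_nat_const mulnC.
Qed.

Lemma degree_corona_edge (e : edge G1) : @degree C (inl (inr e)) = 2%N.
Proof.
by rewrite degreeE big_sumType big_sumType /= !big1_eq !addn0 sum_nat_endpoints.
Qed.

Lemma degree_corona_copy (e : edge G1) (u : G2) :
  @degree C (inr (e, u)) = (2 + degree u)%N.
Proof.
rewrite degreeE big_sumType big_sumType /= big1_eq addn0 sum_nat_endpoints.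
congr (_ + _)%N; rewrite (degreeE u).
rewrite (eq_bigr (fun p : edge G1 * G2 => (e == p.1) && adj u p.2 : nat)); last by case.
rewrite -(pair_bigA _ (fun f w => (e == f) && adj u w : nat))%N /=.
rewrite (bigD1 e) //= eqxx [X in (_ + X)%N]big1 ?addn0 // => f fe.
by rewrite big1 // => w _; rewrite eq_sym (negPf fe).
Qed.

End CoronaDegrees.

(** * The incidence matrix of the orientation *)

Lemma is_sign_sqr (z : int) : is_sign z -> z * z = 1.
Proof. by case/orP=> /eqP->. Qed.

Definition inc_mx (R : nzRingType) (G : signed_graph) (th : r_orientation G) :
    'M[R]_(#|G|, #|edge G|) :=
  \matrix_(i, j) (th (enum_val i) (enum_val j))%:~R.

(** On the diagonal every incident edge adds a squared sign, giving the degree. Off it, only the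
    edge joining [u] and [v], if any, survives, and [theta_mul] gives its signature. *)
Lemma inc_mx_mul_tr (F : numFieldType) (G : signed_graph) (th : r_orientation G) :
  inc_mx F th *m (inc_mx F th)^T = Q_mx F G.
Proof.
apply/matrixP => i j; rewrite !mxE.
set u := enum_val i; set v := enum_val j.
transitivity ((\sum_(e : edge G) th u e * th v e)%:~R : F).
  rewrite rmorph_sum [RHS](reindex_onto enum_val enum_rank) /=; last first.
    by move=> e _; rewrite enum_rankK.
  rewrite [RHS](eq_bigl predT) => [|k]; last by rewrite enum_valK eqxx.
  by apply: eq_bigr => k _; rewrite !mxE -rmorphM.
have [eij|nij] := eqVneq i j.
  have <- : u = v by rewrite /u eij.
  rewrite mulr1n adj_irr addr0 -(sum_nat_incident u) natr_sum rmorph_sum.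
  apply: eq_bigr => e _; have [ue|ue] := boolP (u \in val e).
    by rewrite is_sign_sqr // (theta_end th ue).
  by rewrite (theta_out th ue) mul0r.
rewrite mulr0n add0r.
have uv : u != v by rewrite (inj_eq enum_val_inj).
have th0 e : val e != [set u; v] -> th u e * th v e = 0.
  move=> ne; have [ue|ue] := boolP (u \in val e); last first.
    by rewrite (theta_out th ue) mul0r.
  have [ve|ve] := boolP (v \in val e); last by rewrite (theta_out th ve) mulr0.
  by have [_ /eqP] := edge_of_endpoints uv ue ve; rewrite (negPf ne).
case: ifPn => [/adj_edge [e he]|nadj].
  rewrite (bigD1 e) //= (theta_mul th he) big1 ?addr0 // => f fe.
  by apply: th0; rewrite -he (inj_eq val_inj).
rewrite big1 // => e _; apply: th0; apply: contraNneq nadj => he.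
by have [] := @edge_of_endpoints _ e u v uv; rewrite ?he ?inE ?eqxx ?orbT.
Qed.

(** * The signless Laplacian of the corona as a bordered block matrix *)

Section CoronaBlock.
Variables (F : numFieldType) (R : comNzRingType) (phi : {rmorphism F -> R}).
Variables (G1 : signed_graph) (th : r_orientation G1) (G2 : marked_signed_graph).
Local Notation C := (sen_corona th G2).
Local Notation copies := (\sum_(e < #|edge G1|) (1 + #|G2|))%N.

(* Each subdivision vertex is grouped with the copy of [G2] attached to its
   edge, as a first, isolated vertex of that copy. *)
Definition corona_enum (i : 'I_(#|G1| + copies)) : C :=
  match split i with
  | inl a => inl (inl (enum_val a))
  | inr k => let: existT e w := tagnat.sig k in
             match split w with
             | inl _ => inl (inr (enum_val e))
             | inr b => inr (enum_val e, enum_val b)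
             end
  end.

Definition corona_rank (x : C) : 'I_(#|G1| + copies) :=
  let copy e w := rshift #|G1|
    (tagnat.rank (existT (fun=> 'I_(1 + #|G2|)) e w)) in
  match x with
  | inl (inl v) => lshift copies (enum_rank v)
  | inl (inr e) => copy (enum_rank e) (lshift #|G2| ord0)
  | inr (e, u) => copy (enum_rank e) (rshift 1 (enum_rank u))
  end.

Lemma corona_enum_bij : bijective corona_enum.
Proof.
exists corona_rank => [i|x].
  rewrite /corona_enum -[i in RHS]splitK; case: (split i) => [a|k] /=.
    by rewrite enum_valK.
  rewrite -[k in RHS]tagnat.sigK; case: (tagnat.sig k) => e w /=.
  rewrite -[w in RHS]splitK; case: (split w) => [o|b] /=; last by rewrite !enum_valK.
  by rewrite enum_valK (ord1 o).
case: x => [[v|e]|[e u]]; rewrite /corona_enum /corona_rank.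
- by rewrite (unsplitK (inl _)) enum_rankK.
- by rewrite (unsplitK (inr _)) tagnat.rankK /= (unsplitK (inl _)) enum_rankK.
- by rewrite (unsplitK (inr _)) tagnat.rankK /= (unsplitK (inr _)) !enum_rankK.
Qed.

(** Used at [y = t - 2]: a subdivision vertex has degree 2, and each vertex of a copy gains 2, so
    one shift serves the whole block. *)
Definition copy_mx (y : R) : 'M[R]_(1 + #|G2|) :=
  block_mx y%:M 0 0 (y%:M - map_mx phi (Q_mx F G2)).

Definition copy_vec : 'cV[R]_(1 + #|G2|) := col_mx 1%:M (map_mx phi (mu_vec F G2)).

(** Stated on vertices rather than indices, so that the enumeration can be changed by
    [det_reindex]. *)
Definition Q_entry (G : signed_graph) (t : R) (x y : G) : R :=
  (t - (degree x)%:R) *+ (x == y) - (if adj x y then (sigma x y)%:~R else 0).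

Lemma scalar_sub_Q_mxE (G : signed_graph) (t : R) :
  t%:M - map_mx phi (Q_mx F G) =
  \matrix_(i, j) Q_entry t (enum_val i) (enum_val j).
Proof.
apply/matrixP => i j; rewrite !mxE /Q_entry (inj_eq enum_val_inj).
rewrite rmorphD rmorphMn rmorph_nat mulrnBl opprD addrA; congr (_ - _).
by case: ifP; rewrite ?rmorph_int ?rmorph0.
Qed.

Lemma det_corona_block (gamma : nat) (t : R) : regular G1 gamma ->
  \det (t%:M - map_mx phi (Q_mx F C)) =
  \det (block_mx (t - (gamma * (1 + #|G2|))%:R)%:M
     (- \mxrow_j (col j (map_mx phi (inc_mx F th)) *m copy_vec^T))
     (- \mxcol_j (copy_vec *m (col j (map_mx phi (inc_mx F th)))^T))
     (\mxdiag_(j < #|edge G1|) copy_mx (t - 2))).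
Proof.
move=> hreg; rewrite scalar_sub_Q_mxE (det_reindex _ corona_enum_bij).
have thE v (e : edge G1) :
    (if v \in val e then (th v e)%:~R else 0) = (th v e)%:~R :> R.
  by case: ifPn => // /(theta_out th) ->.
have thmuE v (e : edge G1) (u : G2) : (if v \in val e then (th v e * mu u)%:~R else 0) =
    (th v e)%:~R * (mu u)%:~R :> R.
  by rewrite rmorphM -thE; case: ifP; rewrite ?mul0r.
congr (\det _); apply/matrixP => i j; rewrite mxE /corona_enum.
rewrite -[i in RHS]splitK -[j in RHS]splitK.
case: (split i) => [a|k]; case: (split j) => [b|l] /=.
- rewrite block_mxEul !mxE /Q_entry degree_corona_vertex hreg /= subr0.
  by rewrite -!(inj_eq enum_val_inj).
- rewrite block_mxEur !mxE big_ord1 !mxE /tagnat.sig1 /tagnat.sig2.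
  case: (tagnat.sig l) => e w /=; rewrite /Q_entry.
  case: (split w) => [o|c] /=; rewrite ?thE ?thmuE mulr0n sub0r !mxE ?ord1 rmorph_int.
    by rewrite mulr1.
  by rewrite rmorph_int.
- rewrite block_mxEdl !mxE big_ord1 !mxE /tagnat.sig1 /tagnat.sig2.
  case: (tagnat.sig k) => e w /=; rewrite /Q_entry.
  case: (split w) => [o|c] /=; rewrite ?thE ?thmuE mulr0n sub0r !mxE ?ord1 rmorph_int.
    by rewrite mul1r.
  by rewrite rmorph_int mulrC.
- rewrite block_mxEdr !mxE /tagnat.sig1 /tagnat.sig2 /copy_mx scalar_sub_Q_mxE.
  case: (tagnat.sig k) (tagnat.sig l) => [e w] [f z] /=.
  have [<-|ef] := eqVneq e f; last first.
    have ef' : (enum_val e == enum_val f) = false.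
      by rewrite (inj_eq enum_val_inj) (negPf ef).
    rewrite mxE /Q_entry; case: (split w) (split z) => [o|b] [o'|c] /=.
    + by rewrite (inj_eq inl_inj) (inj_eq inr_inj) ef' subr0.
    + by rewrite mulr0n subr0.
    + by rewrite mulr0n subr0.
    + by rewrite (inj_eq inr_inj) xpair_eqE ef' subr0.
  rewrite conform_mx_id mxE.
  case: (split w) => [o|b]; rewrite mxE; case: (split z) => [o'|c] /=.
  + by rewrite !mxE /Q_entry !eqxx degree_corona_edge /= subr0 !ord1.
  + by rewrite mxE /Q_entry mulr0n subr0.
  + by rewrite mxE /Q_entry mulr0n subr0.
  + rewrite mxE /Q_entry degree_corona_copy (inj_eq inr_inj) xpair_eqE eqxx /=.
    by rewrite eqxx natrD opprD addrA.
Qed.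

End CoronaBlock.

(** * The determinant over an extension field *)

Lemma quad_form_inv_block (K : fieldType) (p : nat) (y : K) (N : 'M[K]_p)
    (u : 'cV[K]_p) :
  y != 0 -> N \in unitmx ->
  ((col_mx 1%:M u)^T *m invmx (block_mx (y%:M : 'M_1) 0 0 N) *m col_mx 1%:M u) 0 0 =
  y^-1 + (u^T *m invmx N *m u) 0 0.
Proof.
move=> y0 uN; have uy : (y%:M : 'M_1) \in unitmx by rewrite unitmxE det_scalar1 unitfE.
rewrite invmx_block_diag ?unitmxE ?det_ublock ?unitrM -?unitmxE ?uy ?uN //.
rewrite tr_col_mx mul_row_block !mulmx0 addr0 add0r mul_row_col mxE trmx1.
by rewrite mul1mx mulmx1 invmx_scalar mxE.
Qed.

(** The isolated vertex of each block adds a factor [y] to its determinant and [y^-1] to its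
    quadratic form. The field [K] is kept general so that [y] can be an indeterminate. *)
Lemma det_corona_field (F : numFieldType) (K : fieldType) (phi : {rmorphism F -> K})
    (G1 : signed_graph) (th : r_orientation G1) (G2 : marked_signed_graph)
    (gamma : nat) (lam : 'I_#|G1| -> F) (y : K) :
  regular G1 gamma -> eigenvalues (Q_mx F G1) lam -> y != 0 ->
  let N := y%:M - map_mx phi (Q_mx F G2) in
  let u := map_mx phi (mu_vec F G2) in
  N \in unitmx ->
  \det ((y + 2)%:M - map_mx phi (Q_mx F (sen_corona th G2))) =
  (y * \det N) ^+ #|edge G1| *
  \prod_(j < #|G1|) (y + 2 - (gamma * (1 + #|G2|))%:R -
     (y^-1 + (u^T *m invmx N *m u) 0 0) * phi (lam j)).
Proof.
move=> hreg hlam y0 N u uN.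
rewrite (det_corona_block _ _ _ _ hreg) addrK det_bordered_copies; last first.
  by rewrite unitmxE det_ublock det_scalar1 unitrM unitfE y0.
rewrite quad_form_inv_block // det_ublock det_scalar1 -/N -/u.
rewrite (map_trmx phi (inc_mx F th)) -map_mxM inc_mx_mul_tr.
by rewrite (det_scalar_sub_scale _ _ _ hlam).
Qed.

(** * Clearing denominators and evaluating *)

Lemma charfE (F : numFieldType) (n : nat) (M : 'M[F]_n) (t : {poly F}) (x : F) :
  charf M t.[x] = (\det (t%:M - map_mx polyC M)).[x].
Proof.
rewrite -[RHS]/(horner_eval x _) -det_map_mx map_mxB map_scalar_mx -map_mx_comp.
congr (\det (_ - _)); apply/matrixP => i j.
by rewrite !mxE /= /horner_eval hornerC.
Qed.

Lemma clear_denominators (K : fieldType) (y a c l q : K) : y != 0 ->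
  (a - (y^-1 + c) * l) * (y * q) = a * (y * q) - (q + y * (c * q)) * l.
Proof. by move=> y0; field. Qed.

(** Each of the [#|G1|] eigenvalue factors absorbs one factor ['X * q], which clears [1/X] and the
    coronal and leaves an identity between polynomials. *)
Lemma char_poly_corona (F : numFieldType) (G1 : signed_graph) (th : r_orientation G1)
    (G2 : marked_signed_graph) (gamma : nat) (lam : 'I_#|G1| -> F) :
  regular G1 gamma -> eigenvalues (Q_mx F G1) lam ->
  let p := rat_num (coronal (Q_mx F G2)) in
  let q := rat_den (coronal (Q_mx F G2)) in
  \det (('X + 2)%:M - map_mx polyC (Q_mx F (sen_corona th G2))) *
    ('X * q) ^+ #|G1| =
  ('X * char_poly (Q_mx F G2)) ^+ #|edge G1| *
  \prod_(j < #|G1|) (('X + 2 - (gamma * (1 + #|G2|))%:R) * ('X * q) -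
     (q + 'X * p) * (lam j)%:P).
Proof.
move=> hreg hlam p q.
pose phi : {rmorphism F -> ratfun F} := @tofrac {poly F} \o polyC.
pose y : ratfun F := tofrac 'X.
have y0 : y != 0 by rewrite tofrac_eq0 polyX_eq0.
have NE : y%:M - map_mx phi (Q_mx F G2) =
    map_mx (@tofrac {poly F}) (char_poly_mx (Q_mx F G2)).
  by rewrite map_mxB map_scalar_mx -map_mx_comp.
(* The determinant is a monic polynomial, hence nonzero in [F(X)], whatever its roots. *)
have uN : y%:M - map_mx phi (Q_mx F G2) \in unitmx.
  by rewrite NE unitmxE det_map_mx unitfE tofrac_eq0 monic_neq0 ?char_poly_monic.
have := det_corona_field (phi := phi) th hreg hlam y0 uN.
set s := (_ *m _) 0 0.
have sE : s = coronal (Q_mx F G2) by rewrite /s NE.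
rewrite {}sE {uN} NE det_map_mx -/(char_poly _) => detE.
apply/eqP; rewrite -tofrac_eq; apply/eqP.
rewrite rmorphM rmorphXn /= -det_map_mx map_mxB map_scalar_mx -map_mx_comp.
rewrite rmorphD rmorph_nat -/y -/phi detE [RHS]rmorphM rmorphXn -mulrA.
congr (_ * _); first by rewrite rmorphM.
rewrite rmorph_prod -[X in _ ^+ X](card_ord #|G1|) -prodr_const -big_split.
apply: eq_bigr => j _ /=; set g := (gamma * _)%N.
rewrite !(tofracB, tofracM, tofracD) -/p rat_numE -/q [tofrac g%:R]rmorph_nat -/y.
by rewrite -[tofrac _%:P]/(phi _) tofrac1; apply: clear_denominators.
Qed.

(** [hdef] excludes a negative power of [x - 2] at [x = 2], where inversion would return the default
    value zero. *)
Theorem theorem5p21 (F : numFieldType) (G1 G2 : marked_signed_graph)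
    (n1 n2 m1 gamma1 : nat) (th : r_orientation G1)
    (hn1 : #|G1| = n1) (hm1 : #|edge G1| = m1) (hn2 : #|G2| = n2)
    (hreg : regular G1 gamma1)
    (lam : 'I_#|G1| -> F) (hlam : eigenvalues (Q_mx F G1) lam)
    (x : F)
    (hdef : (n1 <= m1)%N \/ x != 2)
    (hpole : ~~ is_pole (coronal (Q_mx F G2)) (x - 2)) :
  charf (Q_mx F (sen_corona th G2)) x =
    (x - 2) ^ (m1%:Z - n1%:Z) * charf (Q_mx F G2) (x - 2) ^+ m1 *
    \prod_(j < #|G1|)
      ((x - gamma1%:R - gamma1%:R * n2%:R) * (x - 2) -
       (1 + (x - 2) * rat_eval (coronal (Q_mx F G2)) (x - 2)) * lam j).
Proof.
rewrite -{}hn1 -{}hm1 -{}hn2 in hdef *.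
have := char_poly_corona th G2 hreg hlam; cbv zeta.
set p := rat_num _; set q := rat_den _; set P := \det _.
set y := x - 2; pose s := p.[y] / q.[y] => idP.
(* This is [hpole] unfolded: [y] is not a root of the reduced denominator. *)
have q0 : q.[y] != 0 by [].
rewrite /rat_eval -/p -/q -/s -/y.
have -> : charf (Q_mx F (sen_corona th G2)) x = P.[y].
  rewrite -charfE; congr (charf _ _).
  by rewrite !hornerE /= /y; ring.
have -> : charf (Q_mx F G2) y = (char_poly (Q_mx F G2)).[y].
  by rewrite -[X in charf _ X]hornerX charfE.
set c := char_poly _ in idP *.
set Pi := (X in _ = _ * X) in idP.
(* Each factor releases one [q.[y]], because [q.[y] + y * p.[y] = q.[y] * (1 + y * s)]. *)
have PiE : Pi.[y] = q.[y] ^+ #|G1| * \prod_(j < #|G1|)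
    ((x - gamma1%:R - gamma1%:R * #|G2|%:R) * y - (1 + y * s) * lam j).
  rewrite /Pi horner_prod -[X in _ ^+ X](card_ord #|G1|) -prodr_const -big_split.
  apply: eq_bigr => j _.
  rewrite -[(gamma1 * _)%:R]polyC_natr !hornerE /= natrM natrD /s /y.
  by field.
clearbody s.
have [le_nm|y0] : (#|G1| <= #|edge G1|)%N \/ y != 0.
- by case: hdef => [->|h]; [left|right; rewrite subr_eq0].
(* Here [y] may be zero, so the power of ['X] is cancelled between polynomials, before
   evaluation. *)
- have {}idP : P * q ^+ #|G1| = 'X^(#|edge G1| - #|G1|) * c ^+ #|edge G1| * Pi.
    have X0 : ('X : {poly F}) ^+ #|G1| != 0 by rewrite expf_neq0 ?polyX_eq0.
    apply: (mulIf X0); rewrite mulrAC -mulrA -exprMn idP.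
    rewrite exprMn -[in 'X ^+ #|edge G1|](subnK le_nm) exprD.
    by rewrite (mulrAC _ 'X^#|G1|) (mulrAC _ 'X^#|G1|).
  have := congr1 (fun r => r.[y]) idP.
  rewrite !hornerE PiE => idy; apply: (mulIf (expf_neq0 #|G1| q0)).
  rewrite idy subzn // -exprnP -[RHS]mulrA; congr (_ * _).
  exact: mulrC.
(* Here the exponent may be negative, but [y] is nonzero and can be cancelled after evaluation. *)
- have := congr1 (fun r => r.[y]) idP.
  rewrite !hornerE PiE => idy.
  have yq0 : (y * q.[y]) ^+ #|G1| != 0 by rewrite expf_neq0 ?mulf_neq0.
  have cancel_pow (a b z r w : F) : z != 0 -> a * b * (r * w) = a / z * b * w * (z * r).
    by move=> z0; field.
  apply: (mulIf yq0); rewrite idy expfzDr // -exprnN -exprnP !exprMn.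
  by apply: cancel_pow; rewrite expf_neq0.
Qed.
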